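(* Let $\rho_{0:T-1}$ be a given sequence of (prior) policies and $\lambda$ a given (prior) value of the risk-sensitivity parameter, and let $q^*(\xi_{0:T}) = p(\xi_{0:T}\mid \mathcal{O}_{0:T};\rho_{0:T-1},\lambda)$ be the posterior trajectory density obtained with policies $\rho_{0:T-1}$ and parameter $\lambda$. Consider the maximization problem $$\{\pi^*_{0:T-1},\gamma^*\} = \operatorname*{arg\,max}_{\pi_{0:T-1},\,\gamma}\ \mathcal{E}(q^*,\pi_{0:T-1},\gamma)$$ over policy sequences $\pi_{0:T-1}$ (each normalized, $\int \pi_t(u_t\mid x_t)\,\mathrm{d}u_t=1$) and over $\gamma$. The objective attains an optimum for $$\pi_t^* = \frac{p(\xi_t\mid\mathcal{O}_{0:T};\rho_{0:T-1},\lambda)}{p(x_t\mid\mathcal{O}_{0:T};\rho_{0:T-1},\lambda)} = p(u_t\mid x_t,\mathcal{O}_{0:T};\rho_{0:T-1},\lambda),$$ $$\gamma^* = \frac{T+1}{\mathbb{E}_{p(\xi_{0:T}\mid\mathcal{O}_{0:T};\rho_{0:T-1},\lambda)}\left[C(\xi_{0:T})\right]}.$$ Here $p(u_t\mid x_t,\mathcal{O}_{0:T};\rho_{0:T-1},\lambda)$ is the conditional probability of the action $u_t$ conditioned on the state $x_t$ and the optimality variables $\mathcal{O}_{0:T}$, parametrized by the former policy sequence $\rho_{0:T-1}$ and risk-sensitivity parameter $\lambda$.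
   Context: States $x_t\in\mathbb{R}^{n_x}$, actions $u_t\in\mathbb{R}^{n_u}$, $\xi_t=(x_t,u_t)$, finite horizon $T$; $\xi_{0:T}$ denotes the trajectory $\{\xi_0,\dots,\xi_{T-1},x_T\}$ (at the terminal time $\xi_T$ means $x_T$). The dynamics are deterministic, $x_{t+1}=f_t(x_t,u_t)$ for $t=0,\dots,T-1$, with given initial state $\mathfrak{x}_0$; they are represented by $p(x_{t+1}\mid\xi_t)=\delta(x_{t+1}-f_t(\xi_t))$ and $p(x_0)=\delta(x_0-\mathfrak{x}_0)$, where $\delta$ is the Dirac delta distribution. The cost is $C(\xi_{0:T}) = c_T(x_T)+\sum_{t=0}^{T-1}c_t(\xi_t)$ with nonnegative stage costs $c_t$ and nonnegative terminal cost $c_T$. A (probabilistic) policy $\pi_t(u_t\mid x_t)$ determines the probability of taking action $u_t$ at time $t$ given state $x_t$. Optimality variables $\mathcal{O}_0,\dots,\mathcal{O}_T$ are introduced as observations; $\mathcal{O}_t$ is shorthand for $\mathcal{O}_t=1$, with observation model $$p(\mathcal{O}_t\mid\xi_t;\gamma)=\gamma\exp(-\gamma c_t(\xi_t)),\ t<T,\qquad p(\mathcal{O}_T\mid x_T;\gamma)=\gamma\exp(-\gamma c_T(x_T)),$$ where $\gamma>0$ is the risk-sensitivity parameter. The joint model is $$p(\xi_{0:T},\mathcal{O}_{0:T};\pi_{0:T-1},\gamma)=p(x_0)\,p(\mathcal{O}_T\mid x_T;\gamma)\prod_{t=0}^{T-1}p(\mathcal{O}_t\mid\xi_t;\gamma)\,p(x_{t+1}\mid\xi_t)\,\pi_t(u_t\mid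 x_t).$$ The posterior $p(\xi_{0:T}\mid\mathcal{O}_{0:T};\rho_{0:T-1},\lambda)$ is the conditional density of $\xi_{0:T}$ given $\mathcal{O}_{0:T}$ in the joint model with $\pi=\rho$ and $\gamma=\lambda$; $p(\xi_t\mid\mathcal{O}_{0:T};\rho_{0:T-1},\lambda)$ and $p(x_t\mid\mathcal{O}_{0:T};\rho_{0:T-1},\lambda)$ are its marginals. The evidence lower bound is $$\mathcal{E}(q,\pi_{0:T-1},\gamma)=\mathbb{E}_{q(\xi_{0:T})}\left[\log\frac{p(\xi_{0:T},\mathcal{O}_{0:T};\pi_{0:T-1},\gamma)}{q(\xi_{0:T})}\right].$$ *)

(* Defs.v *)
From HB Require Import structures.
From mathcomp Require Import all_boot all_order all_algebra.
From mathcomp Require Import all_classical all_reals all_analysis.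

Set Implicit Arguments.
Unset Strict Implicit.
Unset Printing Implicit Defensive.

Import Order.TTheory GRing.Theory Num.Theory.
Import numFieldNormedType.Exports.

Local Open Scope classical_set_scope.
Local Open Scope ring_scope.

(* R^n with its Borel sigma-algebra (the product sigma-algebra on tuples). *)
Notation vec R n := (n.-tuple (measurableTypeR R)).

Section pushforward_mfun.
Context d1 d2 (T1 : measurableType d1) (T2 : measurableType d2)
  (R : realType).
Variables (m : {measure set T1 -> \bar R}) (f : {mfun T1 >-> T2}).

Definition mpush : set T2 -> \bar R := pushforward m f.

Let mf : measurable_fun setT f. Proof. exact: measurable_funPT. Qed.

Let mpush0 : mpush set0 = 0%E.
Proof. by rewrite /mpush /pushforward preimage_set0 measure0. Qed.

Let mpush_ge0 A : (0 <= mpush A)%E. Proof. exact: measure_ge0. Qed.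

Let mpush_sigma_additive : semi_sigma_additive mpush.
Proof.
exact: (@measure_semi_sigma_additive _ _ _
  (pushforward m f : {measure set T2 -> \bar R})).
Qed.

HB.instance Definition _ := isMeasure.Build _ _ _ mpush
  mpush0 mpush_ge0 mpush_sigma_additive.

End pushforward_mfun.

(* The n-fold product of a sigma-finite measure, as a measure on n-tuples. *)
Section power_measure.
Context d (V : measurableType d) (R : realType).

Section cons.
Variable n : nat.

Definition tcons (p : V * n.-tuple V) : n.+1.-tuple V :=
  [tuple of p.1 :: p.2].

Lemma measurable_tcons : measurable_fun setT tcons.
Proof. exact: measurable_cons. Qed.

HB.instance Definition _ := isMeasurableFun.Build _ _ _ _ tcons
  measurable_tcons.

Variables (mu : {sigma_finite_measure set V -> \bar R})
  (m : {sigma_finite_measure set (n.-tuple V) -> \bar R}).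

Definition cons_measure : set (n.+1.-tuple V) -> \bar R :=
  mpush (mu \x m)%E tcons.

HB.instance Definition _ := Measure.on cons_measure.

Let cons_measure_sigma_finite : sigma_finite setT cons_measure.
Proof.
have /sigma_finiteP[F [TF ndF Ffin]] := sigma_finiteT mu.
have /sigma_finiteP[G [TG ndG Gfin]] := sigma_finiteT m.
pose g (v : n.+1.-tuple V) := (thead v, [tuple of behead v]).
have mg : measurable_fun setT g.
  by apply: measurable_fun_pair; [exact: measurable_tnth|
    exact: measurable_behead].
exists (fun i => g @^-1` (F i `*` G i)).
  rewrite -preimage_bigcup; apply/esym; rewrite -subTset => v _ /=.
  have [i _ Fi] : (\bigcup_i F i) (g v).1 by rewrite -TF.
  have [k _ Gk] : (\bigcup_i G i) (g v).2 by rewrite -TG.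
  exists (maxn i k) => //; split => /=.
    by move: Fi; apply/subsetPset/ndF/leq_maxl.
  by move: Gk; apply/subsetPset/ndG/leq_maxr.
move=> i; have [mFi Fi] := Ffin i; have [mGi Gi] := Gfin i; split.
  by rewrite -[X in measurable X]setTI; apply: mg => //; exact: measurableX.
rewrite /cons_measure /mpush /pushforward -comp_preimage.
rewrite (_ : g \o tcons = id); last first.
  by apply/funext => -[x v]; congr pair; apply/val_inj.
by rewrite /= preimage_id product_measure1E// lte_mul_pinfty// ge0_fin_numE.
Qed.

HB.instance Definition _ := Measure_isSigmaFinite.Build _ _ _ cons_measure
  cons_measure_sigma_finite.

End cons.

Fixpoint power_measure (mu : {sigma_finite_measure set V -> \bar R}) (n : nat) :
    {sigma_finite_measure set (n.-tuple V) -> \bar R} :=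
  match n with
  | 0%N => \d_([tuple] : 0.-tuple V)
  | n'.+1 => cons_measure mu (power_measure mu n')
  end.

End power_measure.

Definition lebesgue_vec (R : realType) (n : nat) :
    {sigma_finite_measure set (vec R n) -> \bar R} :=
  power_measure (@lebesgue_measure R) n.

Section model.
Context dX dU (X : measurableType dX) (U : measurableType dU) (R : realType).
Variable mu : {sigma_finite_measure set U -> \bar R}.

(* xi_{0:T} = (((x_0, u_0), ..., (x_{T-1}, u_{T-1})), x_T). *)
Local Notation traj T := (T.-tuple (X * U)%type * X)%type.

Definition state_action T (t : 'I_T) (xi : traj T) : X * U := tnth xi.1 t.
Definition state T (t : 'I_T) (xi : traj T) : X := (tnth xi.1 t).1.
Definition action T (t : 'I_T) (xi : traj T) : U := (tnth xi.1 t).2.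

Section step.
Variables (T : nat) (f : {mfun (X * U)%type >-> X}).

Definition traj_step (p : traj T * U) : traj T.+1 :=
  ([tuple of rcons p.1.1 (p.1.2, p.2)], f (p.1.2, p.2)).

Lemma measurable_traj_step : measurable_fun setT traj_step.
Proof.
have mxu : measurable_fun setT (fun p : traj T * U => (p.1.2, p.2)).
  apply: measurable_fun_pair => //.
  exact: (measurableT_comp measurable_snd measurable_fst).
apply: measurable_fun_pair; last exact: measurableT_comp.
apply/measurable_fun_tnthP => i.
have [iT|iT] := ltnP i T.
  rewrite (_ : _ \o _ = fun p : traj T * U => tnth p.1.1 (Ordinal iT)).
    apply: (measurableT_comp (measurable_tnth (Ordinal iT))).
    exact: (measurableT_comp measurable_fst measurable_fst).
  apply/funext => p /=; set a := (p.1.2, p.2).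
  by rewrite (tnth_nth a) (tnth_nth a) /= nth_rcons size_tuple iT.
rewrite (_ : _ \o _ = fun p : traj T * U => (p.1.2, p.2)) //.
apply/funext => p /=; set a := (p.1.2, p.2).
rewrite (tnth_nth a) /= nth_rcons size_tuple ltnNge iT /=.
by rewrite eqn_leq iT -ltnS ltn_ord.
Qed.

HB.instance Definition _ := isMeasurableFun.Build _ _ _ _ traj_step
  measurable_traj_step.

End step.

(* The reference measure
     delta(x_0 - x0) dx_0 prod_{t < T} du_t delta(x_{t+1} - f_t(x_t, u_t)) dx_{t+1}
   on trajectories. Every trajectory density below is taken with respect to it,
   so that the Dirac factors p(x_0) and p(x_{t+1} | xi_t), which are common to
   all densities, are carried by the measure. *)
Fixpoint dynamics_measure (x0 : X) (T : nat) :
    ('I_T -> {mfun (X * U)%type >-> X}) -> {measure set (traj T) -> \bar R} :=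
  match T with
  | 0%N => fun _ => \d_(([tuple], x0) : traj 0)
  | T'.+1 => fun f =>
      mpush (dynamics_measure x0 (fun t => f (widen_ord (leqnSn T') t)) \x mu)%E
        (traj_step (f ord_max))
  end.

(* A policy: a conditional density with respect to [mu], [pi x u = pi(u | x)]. *)
Definition is_policy (pi : X -> U -> R) : Prop :=
  [/\ measurable_fun setT (fun z : X * U => pi z.1 z.2),
      forall x u, 0 <= pi x u &
      forall x, (\int[mu]_u (pi x u)%:E = 1)%E].

Section trajectories.
Variable T : nat.
Variable ref : {measure set (traj T) -> \bar R}.
Variables (c : 'I_T -> X * U -> R) (cT : X -> R).

Definition cost (xi : traj T) : R :=
  cT xi.2 + \sum_(t < T) c t (state_action t xi).

(* p(O_t | xi_t; gamma) when the cost of xi_t is r. *)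
Definition observation (gamma r : R) : R := gamma * expR (- (gamma * r)).

Definition joint (pi : 'I_T -> X -> U -> R) (gamma : R) (xi : traj T) : R :=
  observation gamma (cT xi.2) *
  \prod_(t < T) (observation gamma (c t (state_action t xi)) *
                 pi t (state t xi) (action t xi)).

Definition evidence (pi : 'I_T -> X -> U -> R) (gamma : R) : \bar R :=
  (\int[ref]_xi (joint pi gamma xi)%:E)%E.

Definition posterior (pi : 'I_T -> X -> U -> R) (gamma : R) (xi : traj T) : R :=
  joint pi gamma xi / fine (evidence pi gamma).

Section density.
Variable q : traj T -> R.

Definition expect (g : traj T -> \bar R) : \bar R :=
  (\int[ref]_xi ((q xi)%:E * g xi))%E.

(* [lne 0 = -oo], and [0 * -oo = 0] in [\bar R]: points where q vanishes do not
   contribute, and the value is -oo as soon as the joint density vanishes on a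
   set of positive q-probability. *)
Definition elbo (pi : 'I_T -> X -> U -> R) (gamma : R) : \bar R :=
  expect (fun xi => lne (joint pi gamma xi / q xi)%:E).

Definition maximizes_elbo (pi : 'I_T -> X -> U -> R) (gamma : R) : Prop :=
  [/\ forall t, is_policy (pi t), 0 < gamma &
      forall (pi' : 'I_T -> X -> U -> R) (gamma' : R),
        (forall t, is_policy (pi' t)) -> 0 < gamma' ->
        (elbo pi' gamma' <= elbo pi gamma)%E].

Definition law (A : set (traj T)) : \bar R := (\int[ref]_(xi in A) (q xi)%:E)%E.

Definition state_action_law (t : 'I_T) : set (X * U) -> \bar R :=
  pushforward law (state_action t).

Definition state_law (t : 'I_T) : set X -> \bar R :=
  pushforward law (state t).

(* The marginals are in general singular with respect to Lebesgue measure on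
   states (the law of x_0 is a Dirac mass), so their densities are taken with
   respect to [nu \x mu] and [nu] for some sigma-finite [nu] on states. The
   quotient is constrained only where its denominator is nonzero. *)
Definition is_marginal_ratio (t : 'I_T) (pi : X -> U -> R) : Prop :=
  exists (nu : {sigma_finite_measure set X -> \bar R})
         (p_xu : X * U -> R) (p_x : X -> R),
    [/\ [/\ measurable_fun setT p_xu, forall z, 0 <= p_xu z &
            forall A, measurable A ->
              state_action_law t A = (\int[nu \x mu]_(z in A) (p_xu z)%:E)%E],
        [/\ measurable_fun setT p_x, forall x, 0 <= p_x x &
            forall A, measurable A ->
              state_law t A = (\int[nu]_(x in A) (p_x x)%:E)%E] &
        forall x u, p_x x != 0 -> pi x u = p_xu (x, u) / p_x x].

(* [pi] is a conditional density of u_t given x_t under q. *)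
Definition is_conditional_action_density (t : 'I_T) (pi : X -> U -> R) : Prop :=
  forall (A : set X) (B : set U), measurable A -> measurable B ->
    state_action_law t (A `*` B) =
    (\int[state_law t]_(x in A) \int[mu]_(u in B) (pi x u)%:E)%E.

End density.
End trajectories.
End model.

(* Main.v *)
(* By Tonelli along the dynamics, integrating out the states and actions after
   time t turns the posterior into [nu(dx) w_t(x, u) V(f_t(x, u)) mu(du)], with
   [nu] the forward message, [V > 0] the backward message and
   [w_t = p(O_t | x, u) rho_t(u | x)]. This gives the marginal densities, and the
   policy [pi_t(u | x) = w_t V / int w_t V dmu].

   For optimality, let p be the joint density at (pi, gamma) and p' the one at a
   competitor (pi', gamma'). The inequality [r <= exp (r - 1)], applied to
   gamma' / gamma and to each pi'_t / pi_t, gives q-almost everywhere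
   p' <= p exp G with
   [G = (T+1)(gamma'/gamma - 1) - (gamma' - gamma) C + sum_t (pi'_t/pi_t - 1)].
   Hence the objective at the competitor exceeds the one at (pi, gamma) by at
   most E_q G. The parameter terms of E_q G cancel for
   gamma = (T+1) / E_q C, and E_q (pi'_t/pi_t) <= 1 because pi_t is the
   conditional density of u_t given x_t under q. Taking the prior (rho, lambda)
   as competitor bounds the objective at (pi, gamma) from below, since there
   log (p'/q) is the constant log-evidence; it is bounded above through
   q log (p/q) <= p. *)
Require Import Defs.
From HB Require Import structures.
From mathcomp Require Import all_boot all_order all_algebra.
From mathcomp Require Import all_classical all_reals all_analysis.
From mathcomp Require Import measurable_realfun ring lra.

Set Implicit Arguments.
Unset Strict Implicit.
Unset Printing Implicit Defensive.

Import Order.TTheory GRing.Theory Num.Theory.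
Import numFieldNormedType.Exports.

Local Open Scope classical_set_scope.
Local Open Scope ring_scope.

(** * Measures with a density *)

(* [dynamics_measure] is only bundled as a measure; this alias carries a proof of
   sigma-finiteness, so that Tonelli's theorem applies. *)
Definition sigma_finite_of d (T : measurableType d) (R : realType)
    (m : {measure set T -> \bar R}) & sigma_finite setT m : set T -> \bar R := m.

Section sigma_finite_of.
Context d (T : measurableType d) (R : realType).
Variables (m : {measure set T -> \bar R}) (sm : sigma_finite setT m).

HB.instance Definition _ := Measure.copy (sigma_finite_of sm) m.
HB.instance Definition _ :=
  Measure_isSigmaFinite.Build _ _ _ (sigma_finite_of sm) sm.

End sigma_finite_of.


HB.instance Definition _ d1 d2 (T1 : measurableType d1) (T2 : measurableType d2) :=
  isMeasurableFun.Build _ _ _ _ (@snd T1 T2) measurable_snd.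

Section real_functions.
Context d (T : measurableType d) (R : realType).

(** On nonnegative reals inversion is the real power of exponent -1, also at 0, where both give
    0. *)
Lemma measurable_inv_ge0 (D : set T) (f : T -> R) :
  (forall x, 0 <= f x) -> measurable_fun D f ->
  measurable_fun D (fun x => (f x)^-1).
Proof.
move=> f0 mf; under eq_fun do rewrite -powR_inv1//.
exact: (measurableT_comp (measurable_powR (-1)) mf).
Qed.

Lemma measurable_lne_EFin (D : set T) (f : T -> R) :
  measurable_fun D f -> measurable_fun D (fun x => lne (f x)%:E).
Proof.
move=> mf; apply: (measurableT_comp (f := fun r : R => lne r%:E)) => //=.
apply: measurable_fun_ifT => //.
  by apply: measurable_fun_ler.
by apply: measurableT_comp => //; exact: measurable_ln.
Qed.

End real_functions.

Section integral.
Context d (T : measurableType d) (R : realType).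
Variable m : {measure set T -> \bar R}.
Local Open Scope ereal_scope.

(** Positive and negative parts are compared separately, so no integrability is assumed: the
    objective at a competitor may be -oo. *)
Lemma ae_le_integral (f g : T -> \bar R) :
  measurable_fun setT f -> measurable_fun setT g ->
  {ae m, forall x, f x <= g x} -> \int[m]_x f x <= \int[m]_x g x.
Proof.
move=> mf mg fg; rewrite integralE [leRHS]integralE; apply: leeB.
- apply: ae_ge0_le_integral => //; [exact: measurable_funepos..|].
  by apply: filterS fg => x fgx _; rewrite !funeposE ge_max !le_max lexx fgx !orbT.
- apply: ae_ge0_le_integral => //; [exact: measurable_funeneg..|].
  apply: filterS fg => x fgx _.
  by rewrite !funenegE ge_max !le_max lexx leeN2 fgx !orbT.
Qed.

(** If [g] had integral 0 it would vanish almost everywhere, and [f] with it. This keeps a mass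
    positive when its density is multiplied by a positive factor. *)
Lemma integral_gt0_trans (f g : T -> \bar R) :
  measurable_fun setT f -> measurable_fun setT g ->
  (forall x, 0 <= f x) -> (forall x, 0 <= g x) ->
  (forall x, g x = 0 -> f x = 0) ->
  0 < \int[m]_x f x -> 0 < \int[m]_x g x.
Proof.
move=> mf mg f0 g0 gf; rewrite !lt0e => /andP[f_neq0 _].
rewrite integral_ge0// andbT; apply: contra f_neq0 => /eqP intg.
have : \int[m]_x `|g x| = 0.
  by rewrite -intg; apply: eq_integral => x _; rewrite gee0_abs.
move/(ae_eq_integral_abs m measurableT mg) => g_ae0; apply/eqP.
rewrite -[RHS](integral0 m setT); apply: ge0_ae_eq_integral => //.
by apply: filterS g_ae0 => x /= gx xT; rewrite gf// gx.
Qed.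

End integral.

(** The proofs [mq] and [q0] are arguments so that the measure structure declared below can be
    attached to the term. *)
Definition density_measure d (T : measurableType d) (R : realType)
    (m : {measure set T -> \bar R}) (q : T -> R)
    (mq : measurable_fun setT q) (q0 : forall x, 0 <= q x) : set T -> \bar R :=
  fun A => (\int[m]_(x in A) (q x)%:E)%E.

Section density_measure.
Context d (T : measurableType d) (R : realType).
Variables (m : {measure set T -> \bar R}) (q : T -> R).
Variables (mq : measurable_fun setT q) (q0 : forall x, 0 <= q x).
Local Open Scope ereal_scope.

Local Notation qm := (density_measure m mq q0).

Let qm0 : qm set0 = 0. Proof. exact: integral_set0. Qed.

Let qm_ge0 A : 0 <= qm A.
Proof. by apply: integral_ge0 => x _; rewrite lee_fin. Qed.

Let qm_sigma_additive : semi_sigma_additive qm.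
Proof.
apply: semi_sigma_additive_nng_induced; first exact/measurable_EFinP.
by move=> x; rewrite lee_fin.
Qed.

HB.instance Definition _ := isMeasure.Build _ _ _ qm
  qm0 qm_ge0 qm_sigma_additive.

Import HBNNSimple.

Lemma integral_density_nnsfun (h : {nnsfun T >-> R}) :
  \int[qm]_x (h x)%:E = \int[m]_x ((q x)%:E * (h x)%:E).
Proof.
have mqE : measurable_fun setT (EFin \o q) by exact/measurable_EFinP.
have qE0 x : 0 <= (q x)%:E by rewrite lee_fin.
transitivity (\int[qm]_x
   (\sum_(y \in range h) (y * \1_(h @^-1` [set y]) x)%:E)).
  by apply: eq_integral => t tE; rewrite /= fimfunE -fsumEFin.
have mind r : measurable_fun setT (fun x => (r * \1_(h @^-1` [set r]) x)%:E).
  by apply: (measurable_comp measurableT) => //; exact: measurable_funM.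
rewrite ge0_integral_fsum//; last by move=> m' y Ey; exact: nnfun_muleindic_ge0.
transitivity (\int[m]_x (\sum_(y \in range h)
    (y * \1_(h @^-1` [set y]) x)%:E * (q x)%:E)); last first.
  apply: eq_integral => x xE.
  rewrite -ge0_mule_fsuml => [|y]; last exact: nnfun_muleindic_ge0.
  by rewrite fsumEFin // -(fimfunE _ x) muleC.
rewrite ge0_integral_fsum//; last 2 first.
  - by move=> y; exact: emeasurable_funM.
  - by move=> m' y Ey; rewrite mule_ge0// nnfun_muleindic_ge0.
apply: eq_fsbigr => r rhn.
under eq_integral do rewrite EFinM.
rewrite integralZl_indic_nnsfun//.
under [RHS]eq_integral do rewrite EFinM -muleA.
rewrite [RHS]ge0_integralZl//.
- under [in RHS]eq_integral do rewrite muleC.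
  rewrite [in RHS](eq_integral ((EFin \o q) \_ (h @^-1` [set r]))); last first.
    by move=> x xE; rewrite epatch_indic.
  by rewrite -integral_mkcond integral_indic// setIT.
- by apply: emeasurable_funM => //; exact/measurable_EFinP.
- by move=> t Et; rewrite mule_ge0 ?lee_fin.
- by move: rhn; rewrite inE => -[t _ <-]; rewrite lee_fin.
Qed.

(** Monotone convergence along simple approximations of [g], applied on both sides. *)
Lemma ge0_integral_density (g : T -> \bar R) :
  measurable_fun setT g -> (forall x, 0 <= g x) ->
  \int[qm]_x g x = \int[m]_x ((q x)%:E * g x).
Proof.
move=> mg g0; have qE0 x : 0 <= (q x)%:E by rewrite lee_fin.
pose h := nnsfun_approx measurableT mg.
have hg x : (h n x)%:E @[n --> \oo] --> g x.
  by apply: cvg_nnsfun_approx => // y _.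
transitivity (limn (fun n => \int[qm]_x (h n x)%:E)).
  rewrite -monotone_convergence//.
  - by apply: eq_integral => x _; apply/esym/cvg_lim.
  - by move=> n; exact/measurable_EFinP.
  - by move=> n x _; rewrite lee_fin.
  - by move=> x _ a b ab; rewrite lee_fin; exact/lefP/nd_nnsfun_approx.
under eq_fun do rewrite integral_density_nnsfun.
rewrite -monotone_convergence//.
- by apply: eq_integral => x _; apply/cvg_lim => //; exact: cvgeZl.
- by move=> n; apply: emeasurable_funM; exact/measurable_EFinP.
- by move=> n x _; rewrite mule_ge0// lee_fin.
- move=> x _ a b ab; rewrite lee_wpmul2l// lee_fin.
  exact/lefP/nd_nnsfun_approx.
Qed.

End density_measure.

(** * The dynamics measure *)

Section dynamics.
Context dX dU (X : measurableType dX) (U : measurableType dU) (R : realType).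
Variable mu : {sigma_finite_measure set U -> \bar R}.

Local Notation traj T := (T.-tuple (X * U)%type * X)%type.
Local Notation prefix f := (fun t => f (widen_ord (leqnSn _) t)).

Lemma measurable_state_action T (t : 'I_T) :
  measurable_fun setT (@state_action _ _ X U T t).
Proof.
exact: (measurableT_comp (measurable_tnth t) measurable_fst).
Qed.

HB.instance Definition _ T (t : 'I_T) :=
  isMeasurableFun.Build _ _ _ _ (@state_action _ _ X U T t)
    (measurable_state_action t).

Lemma measurable_state T (t : 'I_T) :
  measurable_fun setT (@state _ _ X U T t).
Proof.
exact: (measurableT_comp measurable_fst (measurable_state_action t)).
Qed.

HB.instance Definition _ T (t : 'I_T) :=
  isMeasurableFun.Build _ _ _ _ (@state _ _ X U T t) (measurable_state t).

Lemma state_action_widen T (g : {mfun (X * U)%type >-> X}) (xi : traj T) u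
    (t : 'I_T) :
  state_action (widen_ord (leqnSn T) t) (traj_step g (xi, u)) =
  state_action t xi.
Proof.
rewrite /state_action; set a := (xi.2, u).
by rewrite (tnth_nth a) (tnth_nth a) /= nth_rcons size_tuple ltn_ord.
Qed.

Lemma state_action_max T (g : {mfun (X * U)%type >-> X}) (xi : traj T) u :
  state_action ord_max (traj_step g (xi, u)) = (xi.2, u).
Proof.
rewrite /state_action; set a := (xi.2, u).
by rewrite (tnth_nth a) /= nth_rcons size_tuple ltnn eqxx.
Qed.

(** A left inverse of [traj_step g] for every [g]: the final state is discarded, since the dynamics
    determine it. *)
Definition traj_unstep T (xi : traj T.+1) : traj T * U :=
  (([tuple tnth xi.1 (widen_ord (leqnSn T) i) | i < T],
    (tnth xi.1 ord_max).1), (tnth xi.1 ord_max).2).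

Lemma traj_stepK T (g : {mfun (X * U)%type >-> X}) :
  cancel (@traj_step _ _ X U T g) (@traj_unstep T).
Proof.
move=> [xi u]; rewrite /traj_unstep.
have := state_action_max g xi u; rewrite /state_action => -> /=.
congr pair; rewrite [RHS]surjective_pairing; congr pair.
by apply: eq_from_tnth => i; rewrite tnth_mktuple; exact: state_action_widen.
Qed.

Lemma measurable_traj_unstep T : measurable_fun setT (@traj_unstep T).
Proof.
have mt (i : 'I_T.+1) : measurable_fun setT (fun xi : traj T.+1 => tnth xi.1 i).
  exact: measurable_state_action.
apply: measurable_fun_pair; last first.
  exact: (measurableT_comp measurable_snd (mt ord_max)).
apply: measurable_fun_pair; last first.
  exact: (measurableT_comp measurable_fst (mt ord_max)).
apply/measurable_fun_tnthP => i.
rewrite (_ : _ \o _ = fun xi : traj T.+1 => tnth xi.1 (widen_ord (leqnSn T) i)) //.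
by apply/funext => xi /=; rewrite tnth_mktuple.
Qed.

(** Exhausting rectangles are pulled back along [traj_unstep]; by the cancellation [traj_stepK],
    their pushed-forward measure is the product measure of the rectangles. *)
Lemma dynamics_sigma_finite x0 T (f : 'I_T -> {mfun (X * U)%type >-> X}) :
  sigma_finite setT (dynamics_measure mu x0 f).
Proof.
elim: T f => [|T IH] f.
  exists (fun=> setT) => [|i]; first by rewrite bigcup_const.
  by split => //; rewrite /= diracE ltry.
have /sigma_finiteP[F [TF ndF Ffin]] := sigma_finiteT mu.
have /sigma_finiteP[G [TG ndG Gfin]] := IH (prefix f).
exists (fun i => @traj_unstep T @^-1` (G i `*` F i)).
  rewrite -preimage_bigcup; apply/esym; rewrite -subTset => v _ /=.
  have [i _ Fi] : (\bigcup_i F i) (traj_unstep v).2 by rewrite -TF.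
  have [k _ Gk] : (\bigcup_i G i) (traj_unstep v).1 by rewrite -TG.
  exists (maxn i k) => //; split => /=.
    by move: Gk; apply/subsetPset/ndG/leq_maxr.
  by move: Fi; apply/subsetPset/ndF/leq_maxl.
move=> i; have [mFi Fi] := Ffin i; have [mGi Gi] := Gfin i; split.
  rewrite -[X in measurable X]setTI; apply: measurable_traj_unstep => //.
  exact: measurableX.
rewrite /= /mpush /pushforward -comp_preimage.
rewrite (_ : _ \o _ = id) ?preimage_id; last first.
  by apply/funext => p /=; exact: traj_stepK.
by rewrite product_measure1E// lte_mul_pinfty// ge0_fin_numE.
Qed.

Lemma integral_dynamics0 x0 (f : 'I_0 -> {mfun (X * U)%type >-> X})
    (F : traj 0 -> \bar R) :
  measurable_fun setT F ->
  (\int[dynamics_measure mu x0 f]_xi F xi = F ([tuple], x0))%E.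
Proof. by move=> mF; rewrite integral_dirac// diracT mul1e. Qed.

(** Change of variables along the push-forward, then Tonelli. *)
Lemma integral_dynamics_step x0 T (f : 'I_T.+1 -> {mfun (X * U)%type >-> X})
    (F : traj T.+1 -> \bar R) :
  measurable_fun setT F -> (forall xi, 0 <= F xi)%E ->
  (\int[dynamics_measure mu x0 f]_xi F xi =
   \int[dynamics_measure mu x0 (prefix f)]_xi
     \int[mu]_u F (traj_step (f ord_max) (xi, u)))%E.
Proof.
move=> mF F0.
pose m := sigma_finite_of (dynamics_sigma_finite x0 (prefix f)).
have mstep := measurable_traj_step (T := T) (f ord_max).
transitivity (\int[(m \x mu)%E]_p F (traj_step (f ord_max) p))%E.
  exact: (ge0_integral_pushforward mstep (m \x mu)%E measurableT mF).
rewrite (fubini_tonelli1 (F \o traj_step (f ord_max)))//.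
  exact: measurableT_comp.
by move=> p; exact: F0.
Qed.

End dynamics.

(** * Forward and backward messages *)

Section weights.
Context dX dU (X : measurableType dX) (U : measurableType dU) (R : realType).
Variable mu : {sigma_finite_measure set U -> \bar R}.

Local Notation traj T := (T.-tuple (X * U)%type * X)%type.
Local Notation prefix f := (fun t => f (widen_ord (leqnSn _) t)).

(** The terminal factor is kept apart, as a potential on the last state, so that inductions on the
    horizon can absorb the last step into it. *)
Definition traj_weight T (w : 'I_T -> X * U -> R) (xi : traj T) : R :=
  \prod_(t < T) w t (state_action t xi).

Lemma measurable_traj_weight T (w : 'I_T -> X * U -> R) :
  (forall t, measurable_fun setT (w t)) -> measurable_fun setT (traj_weight w).
Proof.
move=> mw; apply: measurable_prod => t _.
exact: (measurableT_comp (mw t) (measurable_state_action t)).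
Qed.

Lemma traj_weight_ge0 T (w : 'I_T -> X * U -> R) xi :
  (forall t z, 0 <= w t z) -> 0 <= traj_weight w xi.
Proof. by move=> w0; apply: prodr_ge0. Qed.

Lemma traj_weight_step T (w : 'I_T.+1 -> X * U -> R)
    (g : {mfun (X * U)%type >-> X}) (xi : traj T) u :
  traj_weight w (traj_step g (xi, u)) =
  traj_weight (prefix w) xi * w ord_max (xi.2, u).
Proof.
rewrite /traj_weight big_ord_recr/= state_action_max; congr (_ * _).
by apply: eq_bigr => t _; rewrite state_action_widen.
Qed.

(** Only the integral over actions is bounded, uniformly in the state: a policy density may itself
    be unbounded. *)
Definition bounded_weight (B : R) (w : X * U -> R) : Prop :=
  [/\ measurable_fun setT w, forall z, 0 <= w z &
      forall x, (0 < \int[mu]_u (w (x, u))%:E <= B%:E)%E].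

Definition bounded_potential (M : R) (V : X -> R) : Prop :=
  measurable_fun setT V /\ forall x, 0 < V x <= M.

(** One step of the backward recursion. By [messageE], [fine] loses nothing for bounded weights and
    potentials. *)
Definition message (w : X * U -> R) (g : X * U -> X) (V : X -> R) (x : X) : R :=
  fine (\int[mu]_u (w (x, u) * V (g (x, u)))%:E)%E.

Section message.
Variables (B M : R) (w : X * U -> R) (g : {mfun (X * U)%type >-> X}) (V : X -> R).
Hypotheses (wB : bounded_weight B w) (VM : bounded_potential M V).

Let mwV : measurable_fun setT (fun z => w z * V (g z)).
Proof.
have [mw _ _] := wB; have [mV _] := VM.
by apply: measurable_funM => //; exact: measurableT_comp.
Qed.

Let wV0 z : 0 <= w z * V (g z).
Proof.
have [_ w0 _] := wB; have [_ /(_ (g z))/andP[V0 _]] := VM.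
by rewrite mulr_ge0 ?w0 ?ltW.
Qed.

Let msg_bounds x :
  (0 < \int[mu]_u (w (x, u) * V (g (x, u)))%:E <= (B * M)%:E)%E.
Proof.
have [mw w0 /(_ x)/andP[int_gt0 int_le]] := wB; have [_ V0] := VM.
have mw1 : measurable_fun setT (fun u => (w (x, u))%:E).
  by apply/measurable_EFinP; exact: measurableT_comp.
have mwV1 : measurable_fun setT (fun u => (w (x, u) * V (g (x, u)))%:E).
  by apply/measurable_EFinP; exact: (measurableT_comp mwV).
apply/andP; split.
  apply: integral_gt0_trans int_gt0 => //.
  - by move=> u; rewrite lee_fin.
  - by move=> u; rewrite lee_fin.
  - move=> u [/eqP]; rewrite mulf_eq0 => /orP[/eqP->//|].
    by have /andP[/gt_eqF->] := V0 (g (x, u)).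
have M0 : 0 <= M by have /andP[/ltW+] := V0 x; exact: le_trans.
apply: (@le_trans _ _ (\int[mu]_u (M%:E * (w (x, u))%:E))%E).
  apply: ge0_le_integral => //.
  - by move=> u _; rewrite lee_fin.
  - by apply: measurable_funeM.
  - move=> u _; rewrite -EFinM lee_fin mulrC ler_wpM2r//.
    by have /andP[] := V0 (g (x, u)).
rewrite ge0_integralZl//; last by move=> u _; rewrite lee_fin.
by rewrite mulrC EFinM lee_wpmul2l.
Qed.

Lemma messageE x : ((message w g V x)%:E =
  \int[mu]_u (w (x, u) * V (g (x, u)))%:E)%E.
Proof.
have /andP[msg0 msgle] := msg_bounds x.
by rewrite fineK// ge0_fin_numE ?ltW// (le_lt_trans msgle)// ltry.
Qed.

(** Bounded potentials are thus stable under the backward recursion, the bounds being multiplied. *)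
Lemma message_potential : bounded_potential (B * M) (message w g V).
Proof.
split=> [|x]; last by rewrite -lte_fin -lee_fin messageE.
apply: measurableT_comp => //.
apply: (measurable_fun_fubini_tonelli_F (fun z => (w z * V (g z))%:E)).
  exact/measurable_EFinP.
by move=> z; rewrite lee_fin.
Qed.

End message.

(** Since [h] sees only the earlier trajectory and the last action, [traj_unstep] cancels the step,
    and the weight of the prefix leaves the integral over that action. *)
Lemma integral_traj_weight_step x0 T (f : 'I_T.+1 -> {mfun (X * U)%type >-> X})
    (w : 'I_T.+1 -> X * U -> R) (h : traj T * U -> \bar R) (V : X -> R) :
  (forall t, measurable_fun setT (w t)) -> (forall t z, 0 <= w t z) ->
  measurable_fun setT V -> (forall x, 0 <= V x) ->
  measurable_fun setT h -> (forall p, 0 <= h p)%E ->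
  (\int[dynamics_measure mu x0 f]_xi
     (h (traj_unstep xi) * (traj_weight w xi * V xi.2)%:E) =
   \int[dynamics_measure mu x0 (prefix f)]_xi
     ((traj_weight (prefix w) xi)%:E *
      \int[mu]_u (h (xi, u) *
        (w ord_max (xi.2, u) * V (f ord_max (xi.2, u)))%:E)))%E.
Proof.
move=> mw w0 mV V0 mh h0.
have mwV : measurable_fun setT (fun z => w ord_max z * V (f ord_max z)).
  by apply: measurable_funM => //; exact: measurableT_comp.
rewrite integral_dynamics_step; first last.
- move=> xi; rewrite mule_ge0// lee_fin mulr_ge0//; exact: traj_weight_ge0.
- apply: emeasurable_funM.
    exact: (measurableT_comp mh (@measurable_traj_unstep _ _ X U T)).
  apply/measurable_EFinP/measurable_funM; first exact: measurable_traj_weight.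
  exact: (measurableT_comp mV measurable_snd).
apply: eq_integral => xi _; rewrite -ge0_integralZl//; first last.
- by rewrite lee_fin traj_weight_ge0.
- by move=> u _; rewrite mule_ge0// lee_fin mulr_ge0.
- apply: emeasurable_funM; first exact: measurableT_comp.
  apply/measurable_EFinP.
  exact: (measurableT_comp mwV (pair1_measurable xi.2)).
apply: eq_integral => u _.
by rewrite traj_stepK traj_weight_step muleCA -EFinM mulrA.
Qed.

(** By induction on the horizon, replacing the last weight and the potential by their message, a
    potential with bound [B * M]. *)
Lemma integral_traj_weight_bounds x0 T (f : 'I_T -> {mfun (X * U)%type >-> X})
    (w : 'I_T -> X * U -> R) (V : X -> R) (B M : R) :
  (forall t, bounded_weight B (w t)) -> bounded_potential M V ->
  (0 < \int[dynamics_measure mu x0 f]_xi (traj_weight w xi * V xi.2)%:E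
     <= (B ^+ T * M)%:E)%E.
Proof.
elim: T f w V M => [|T IH] f w V M wB VM.
  rewrite integral_dynamics0; last first.
    apply/measurable_EFinP/measurable_funM.
      by apply: measurable_traj_weight; case.
    by case: VM => mV _; exact: (measurableT_comp mV measurable_snd).
  by rewrite /traj_weight big_ord0 !mul1r lte_fin lee_fin; case: VM.
have [mV V0] := VM.
have V_ge0 x : 0 <= V x by have /andP[/ltW] := V0 x.
have mw t : measurable_fun setT (w t) by case: (wB t).
have w0 t z : 0 <= w t z by case: (wB t).
under eq_integral do rewrite -[X in X%:E]mul1r EFinM.
rewrite (@integral_traj_weight_step _ _ f w (cst 1%E))//.
have wmax := wB ord_max.
under eq_integral => xi _.
  under eq_integral do rewrite mul1e.
  rewrite -(messageE (f ord_max) wmax VM) -EFinM; over.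
rewrite exprSr -mulrA.
apply: IH => //.
exact: message_potential.
Qed.

(* Integrating out the states and actions after time [t] turns the terminal
   potential into the backward message [V']; those before time [t] make up the
   measure [nu] of the forward messages. *)
Lemma state_action_disintegration x0 T (f : 'I_T -> {mfun (X * U)%type >-> X})
    (w : 'I_T -> X * U -> R) (V : X -> R) (B M : R) (t : 'I_T) :
  (forall s, bounded_weight B (w s)) -> bounded_potential M V ->
  exists (nu : {sigma_finite_measure set X -> \bar R}) (V' : X -> R) (M' : R),
    bounded_potential M' V' /\
    forall h : X * U -> \bar R, measurable_fun setT h -> (forall z, 0 <= h z)%E ->
      (\int[dynamics_measure mu x0 f]_xi
         (h (state_action t xi) * (traj_weight w xi * V xi.2)%:E) =
       \int[nu]_x \int[mu]_u (h (x, u) * (w t (x, u) * V' (f t (x, u)))%:E))%E.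
Proof.
elim: T f w V M t => [|T IH] f w V M t wB VM; first by case: t.
have [mV V0] := VM.
have V_ge0 x : 0 <= V x by have /andP[/ltW] := V0 x.
have mw s : measurable_fun setT (w s) by case: (wB s).
have w0 s z : 0 <= w s z by case: (wB s).
(* Before the last step, that step is integrated into a message and the induction hypothesis
   supplies [nu]. At the last step, [nu] is built directly and the potential is [V] itself. *)
have [tT|Tt] := ltnP t T.
  have tE : t = widen_ord (leqnSn T) (Ordinal tT) by apply/val_inj.
  have [||nu [V' [M' [V'M' nuE]]]] := IH (prefix f) (prefix w)
    (message (w ord_max) (f ord_max) V) (B * M) (Ordinal tT).
  - by move=> s; exact: wB.
  - exact: message_potential.
  exists nu, V', M'; split=> [|h mh h0]; first exact: V'M'.
  rewrite tE -nuE//.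
  transitivity (\int[dynamics_measure mu x0 f]_xi
      (h (state_action (Ordinal tT) (traj_unstep xi).1) *
       (traj_weight w xi * V xi.2)%:E))%E.
    by apply: eq_integral => xi _; rewrite /state_action/= tnth_mktuple.
  rewrite (@integral_traj_weight_step _ _ f w
    (fun p => h (state_action (Ordinal tT) p.1)))//; last first.
    apply: measurableT_comp => //.
    exact: (measurableT_comp (measurable_state_action _) measurable_fst).
  apply: eq_integral => xi _ /=.
  rewrite ge0_integralZl//; last 2 first.
    apply/measurable_EFinP/measurable_funM.
      exact: (measurableT_comp (mw _) (pair1_measurable _)).
    apply: (measurableT_comp mV).
    exact: (measurableT_comp _ (pair1_measurable _)).
    by move=> u _; rewrite lee_fin mulr_ge0.
  by rewrite -(messageE (f ord_max) (wB ord_max) VM) muleCA EFinM.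
have -> : t = ord_max by apply/val_inj/eqP; rewrite eqn_leq Tt -ltnS ltn_ord.
have mW : measurable_fun setT (traj_weight (prefix w)).
  by apply: measurable_traj_weight => s; exact: mw.
have W0 xi : 0 <= traj_weight (prefix w) xi by apply: traj_weight_ge0 => s; exact: w0.
(* The forward message: the unnormalized law of the state in which the last action is taken. It is
   finite by the bound above with potential 1. *)
pose m : {measure set X -> \bar R} := mpush (density_measure (dynamics_measure mu x0 (prefix f)) mW W0)
  (@snd (T.-tuple (X * U)%type) X).
have sm : sigma_finite setT m.
  apply: fin_num_fun_sigma_finite; first by rewrite measure0.
  apply: lty_fin_num_fun; rewrite /m/= /mpush/pushforward preimage_setT.
  have cM : bounded_potential 1 (cst 1 : X -> R).
    by split=> [|x]; rewrite ?ltr01 ?lexx.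
  have wB' s : bounded_weight B (prefix w s) by exact: wB.
  have /andP[_ /le_lt_trans] := integral_traj_weight_bounds x0 (prefix f) wB' cM.
  by under eq_integral do rewrite mulr1; apply; rewrite ltry.
exists (sigma_finite_of sm), V, M; split=> [|h mh h0]; first exact: VM.
pose G x := (\int[mu]_u (h (x, u) * (w ord_max (x, u) * V (f ord_max (x, u)))%:E))%E.
pose H z := (h z * (w ord_max z * V (f ord_max z))%:E)%E.
have mH : measurable_fun setT H.
  apply: emeasurable_funM => //; apply/measurable_EFinP/measurable_funM => //.
  exact: measurableT_comp.
have H0 z : (0 <= H z)%E by rewrite mule_ge0// lee_fin mulr_ge0.
have mG : measurable_fun setT G by exact: (measurable_fun_fubini_tonelli_F H).
have G0 x : (0 <= G x)%E by apply: integral_ge0 => u _; exact: (H0 (x, u)).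
transitivity (\int[m]_x G x)%E; last by [].
rewrite [RHS]/= /mpush ge0_integral_pushforward// preimage_setT.
rewrite [RHS]ge0_integral_density//; first last.
- by move=> xi; exact: G0.
- exact: measurableT_comp.
transitivity (\int[dynamics_measure mu x0 f]_xi
    ((fun p => h (p.1.2, p.2)) (traj_unstep xi) *
     (traj_weight w xi * V xi.2)%:E))%E.
  by apply: eq_integral => xi _ /=; rewrite -surjective_pairing.
rewrite (@integral_traj_weight_step _ _ f w (fun p => h (p.1.2, p.2)))//.
apply: measurableT_comp => //; apply: measurable_fun_pair => //.
exact: (measurableT_comp measurable_snd measurable_fst).
Qed.

End weights.

(** * Marginal ratios *)

Section marginal_ratio.
Context dX dU (X : measurableType dX) (U : measurableType dU) (R : realType).
Variable mu : {sigma_finite_measure set U -> \bar R}.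
Variables (T : nat) (ref : {measure set (T.-tuple (X * U)%type * X) -> \bar R}).
Variables (q : T.-tuple (X * U)%type * X -> R).
Hypotheses (mq : measurable_fun setT q) (q0 : forall xi, 0 <= q xi).
Local Open Scope ereal_scope.

Lemma integral_state_action_law (t : 'I_T) (h : X * U -> \bar R) :
  measurable_fun setT h -> (forall z, 0 <= h z) ->
  \int[state_action_law ref q t]_z h z =
  \int[ref]_xi ((q xi)%:E * h (state_action t xi)).
Proof.
move=> mh h0; pose m : {measure set _ -> \bar R} := density_measure ref mq q0.
(* The two laws are convertible; only the push-forward of [m] carries a measure structure. *)
transitivity (\int[pushforward m (state_action t)]_z h z); first by [].
rewrite ge0_integral_pushforward//.
rewrite preimage_setT ge0_integral_density//.
  exact: (measurableT_comp mh (measurable_state_action t)).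
by move=> xi; exact: h0.
Qed.

Lemma integral_state_law (t : 'I_T) (g : X -> \bar R) :
  measurable_fun setT g -> (forall x, 0 <= g x) ->
  \int[state_law ref q t]_x g x =
  \int[ref]_xi ((q xi)%:E * g (state t xi)).
Proof.
move=> mg g0; pose m : {measure set _ -> \bar R} := density_measure ref mq q0.
transitivity (\int[pushforward m (state t)]_x g x); first by [].
rewrite ge0_integral_pushforward//.
rewrite preimage_setT ge0_integral_density//.
  exact: (measurableT_comp mg (measurable_state t)).
by move=> xi; exact: g0.
Qed.

(* Rewriting with this opaque measure avoids unfolding [state_law] during
   unification. *)
Lemma state_law_measure (t : 'I_T) :
  exists m : {measure set X -> \bar R}, state_law ref q t = m.
Proof.
pose m : {measure set _ -> \bar R} := density_measure ref mq q0.
by exists (mpush m (state t)).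
Qed.

(** Where [p_x] is nonzero, [p_x * pi = p_xu]. Where it vanishes, so does [p_xu] almost everywhere,
    because both are marginals of the same [q]. *)
Lemma marginal_ratio_integral (t : 'I_T) (pi : X -> U -> R) (h : X * U -> \bar R) :
  is_policy mu pi -> is_marginal_ratio mu ref q t pi ->
  measurable_fun setT h -> (forall z, 0 <= h z) ->
  \int[ref]_xi ((q xi)%:E * h (state_action t xi)) =
  \int[state_law ref q t]_x \int[mu]_u ((pi x u)%:E * h (x, u)).
Proof.
move=> [mpi pi0 pi1] [nu [p_xu [p_x [[mp_xu p_xu0 p_xuE] [mp_x p_x0 p_xE] piE]]]].
have xu_int h' : measurable_fun setT h' -> (forall z, 0 <= h' z) ->
    \int[ref]_xi ((q xi)%:E * h' (state_action t xi)) =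
    \int[nu]_x \int[mu]_u ((p_xu (x, u))%:E * h' (x, u)).
  move=> mh' h'0; rewrite -integral_state_action_law//.
  pose m : {measure set _ -> \bar R} := density_measure ref mq q0.
  pose ms : {measure set _ -> \bar R} := mpush m (state_action t).
  pose md : {measure set _ -> \bar R} := density_measure (nu \x mu) mp_xu p_xu0.
  transitivity (\int[ms]_z h' z); first by [].
  rewrite (eq_measure_integral md) => [|A mA _]; last exact: p_xuE.
  rewrite ge0_integral_density// (fubini_tonelli1 (fun z => (p_xu z)%:E * h' z))//.
    by apply: emeasurable_funM => //; exact/measurable_EFinP.
  by move=> z; rewrite mule_ge0// lee_fin.
have x_int g : measurable_fun setT g -> (forall x, 0 <= g x) ->
    \int[state_law ref q t]_x g x = \int[nu]_x ((p_x x)%:E * g x).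
  move=> mg g0.
  pose m : {measure set _ -> \bar R} := density_measure ref mq q0.
  pose ms : {measure set _ -> \bar R} := mpush m (state t).
  pose md : {measure set _ -> \bar R} := density_measure nu mp_x p_x0.
  transitivity (\int[ms]_z g z); first by [].
  rewrite (eq_measure_integral md) => [|A mA _]; last exact: p_xE.
  by rewrite ge0_integral_density.
move=> mh h0.
have mp_xuh : measurable_fun setT (fun z => (p_xu z)%:E * h z).
  by apply: emeasurable_funM => //; exact/measurable_EFinP.
have p_xuh0 z : 0 <= (p_xu z)%:E * h z by rewrite mule_ge0// lee_fin.
have mpih : measurable_fun setT (fun z => (pi z.1 z.2)%:E * h z).
  by apply: emeasurable_funM => //; exact/measurable_EFinP.
have pih0 z : 0 <= (pi z.1 z.2)%:E * h z by rewrite mule_ge0// lee_fin.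
have mG : measurable_fun setT (fun x => \int[mu]_u ((pi x u)%:E * h (x, u))).
  exact: (measurable_fun_fubini_tonelli_F (fun z => (pi z.1 z.2)%:E * h z)).
have G0 x : 0 <= \int[mu]_u ((pi x u)%:E * h (x, u)).
  by apply: integral_ge0 => u _; exact: (pih0 (x, u)).
pose Z := [set x | p_x x = 0%R].
have mZ : measurable Z.
  rewrite (_ : Z = p_x @^-1` [set 0%R])// -[X in measurable X]setTI.
  exact: mp_x.
have mindZ : measurable_fun setT (fun x => (\1_Z x)%:E : \bar R).
  by apply/measurable_EFinP; exact: measurable_indic.
have indZ0 x : 0 <= (\1_Z x)%:E :> \bar R by rewrite lee_fin.
(* Both sides of the chain compute the probability that the state lies in [Z], which is the integral
   of [p_x] over its own zero set. *)
have null : \int[nu]_x \int[mu]_u ((p_xu (x, u))%:E * (\1_Z x)%:E) = 0.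
  rewrite -(xu_int (fun z => (\1_Z z.1)%:E))//; last first.
    exact: (measurableT_comp mindZ measurable_fst).
  transitivity (\int[state_law ref q t]_x (\1_Z x)%:E).
    by rewrite integral_state_law.
  rewrite x_int//.
  apply: integral0_eq => x _; rewrite indicE; have [|_] := boolP (x \in Z).
    by rewrite inE => ->; rewrite mul0e.
  by rewrite mule0.
rewrite xu_int// x_int//; apply: ge0_ae_eq_integral => //.
- exact: (measurable_fun_fubini_tonelli_F (fun z => (p_xu z)%:E * h z)).
- by apply: emeasurable_funM => //; exact/measurable_EFinP.
- by move=> x _; apply: integral_ge0.
- by move=> x _; rewrite mule_ge0// lee_fin.
have mF : measurable_fun setT
    (fun x => \int[mu]_u ((p_xu (x, u))%:E * (\1_Z x)%:E)).
  apply: (measurable_fun_fubini_tonelli_F (fun z => (p_xu z)%:E * (\1_Z z.1)%:E)).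
    apply: emeasurable_funM; first exact/measurable_EFinP.
    exact: (measurableT_comp mindZ measurable_fst).
  by move=> z; rewrite mule_ge0// lee_fin.
have F_ae0 : ae_eq nu setT
    (fun x => \int[mu]_u ((p_xu (x, u))%:E * (\1_Z x)%:E)) (cst 0).
  apply/(ae_eq_integral_abs nu measurableT mF); rewrite -[RHS]null.
  apply: eq_integral => x _; rewrite gee0_abs//; apply: integral_ge0 => u _.
  by rewrite mule_ge0// lee_fin.
apply: filterS F_ae0 => x /= Fx xT.
have [px0|px_neq0] := eqVneq (p_x x) 0%R; last first.
  rewrite -ge0_integralZl//; first last.
  - by rewrite lee_fin.
  - by move=> u _; exact: (pih0 (x, u)).
  - exact: (measurableT_comp mpih (pair1_measurable x)).
  apply: eq_integral => u _; rewrite muleA -EFinM piE//.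
  by rewrite mulrC divfK.
rewrite px0 mul0e.
(* For almost every [x] in [Z], the density [p_xu (x, u)] vanishes for almost every [u]. *)
have {}Fx : \int[mu]_u `|(p_xu (x, u))%:E| = 0.
  rewrite -[RHS]Fx//; apply: eq_integral => u _.
  by rewrite indicE mem_set// mule1 gee0_abs// lee_fin.
have mp_xux : measurable_fun setT (fun u => (p_xu (x, u))%:E).
  by apply/measurable_EFinP; exact: measurableT_comp.
move/(ae_eq_integral_abs mu measurableT mp_xux) : Fx => p_ae0.
rewrite -[RHS](integral0 mu setT); apply: ge0_ae_eq_integral => //.
- exact: (measurableT_comp mp_xuh (pair1_measurable x)).
- by apply: filterS p_ae0 => u /= pu uT; rewrite pu// mul0e.
Qed.

(** The previous identity for the indicator of a rectangle. *)
Lemma marginal_ratio_conditional_density (t : 'I_T) (pi : X -> U -> R) :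
  is_policy mu pi -> is_marginal_ratio mu ref q t pi ->
  is_conditional_action_density mu ref q t pi.
Proof.
move=> piP pi_ratio A B mA mB.
have mAB : measurable (A `*` B) by exact: measurableX.
pose h z : \bar R := (\1_(A `*` B) z)%:E.
have mh : measurable_fun setT h by apply/measurable_EFinP; exact: measurable_indic.
have h0 z : 0 <= h z by rewrite lee_fin.
pose m : {measure set _ -> \bar R} := density_measure ref mq q0.
pose ms : {measure set _ -> \bar R} := mpush m (state_action t).
transitivity (\int[ms]_z h z).
  by rewrite /h integral_indic// setIT.
transitivity (\int[state_action_law ref q t]_z h z); first by [].
rewrite integral_state_action_law// (marginal_ratio_integral piP)//.
have [mx ->] := state_law_measure t.
rewrite [RHS]integral_mkcond; apply: eq_integral => x _.
rewrite patchE; case: ifPn => xA.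
  rewrite [RHS]integral_mkcond; apply: eq_integral => u _.
  by rewrite patchE /h indicE in_setX /= xA; case: ifPn; rewrite ?mule1 ?mule0.
by apply: integral0_eq => u _; rewrite /h indicE in_setX (negbTE xA) mule0.
Qed.

(** Integrated against its conditional density [pi], the indicator of the zero set of [pi] gives
    0. *)
Lemma marginal_ratio_gt0 (t : 'I_T) (pi : X -> U -> R) :
  is_policy mu pi -> is_marginal_ratio mu ref q t pi ->
  {ae ref, forall xi, 0 < q xi -> 0 < pi (state t xi) (action t xi)}%R.
Proof.
move=> piP pi_ratio; have [mpi pi0 _] := piP.
pose Z := [set z : X * U | pi z.1 z.2 = 0%R].
have mZ : measurable Z.
  rewrite (_ : Z = (fun z => pi z.1 z.2) @^-1` [set 0%R])//.
  by rewrite -[X in measurable X]setTI; exact: mpi.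
have mind : measurable_fun setT (fun z => (\1_Z z)%:E : \bar R).
  by apply/measurable_EFinP; exact: measurable_indic.
have mqind : measurable_fun setT
    (fun xi => (q xi)%:E * (\1_Z (state_action t xi))%:E).
  apply: emeasurable_funM; first exact/measurable_EFinP.
  exact: (measurableT_comp mind (measurable_state_action t)).
have : \int[ref]_xi `|(q xi)%:E * (\1_Z (state_action t xi))%:E| = 0.
  under eq_integral do rewrite gee0_abs ?mule_ge0 ?lee_fin//.
  rewrite (@marginal_ratio_integral t pi (fun z => (\1_Z z)%:E))//.
  have [mx ->] := state_law_measure t.
  apply: integral0_eq => x _; apply: integral0_eq => u _.
  rewrite indicE; have [|_] := boolP ((x, u) \in Z); last by rewrite mule0.
  by rewrite inE /Z /= => ->; rewrite mul0e.
move/(ae_eq_integral_abs ref measurableT mqind); apply: filterS => xi /= q_ind qxi.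
rewrite lt0r pi0 andbT; apply/eqP => pixi.
have := q_ind I; rewrite indicE mem_set// mule1 => -[/eqP].
by rewrite gt_eqF.
Qed.

(** Averaging [pi' / pi] against the conditional density [pi] leaves the mass of [pi'] on the
    actions where [pi] is nonzero. It can be less than 1, as the quotient is 0 where [pi]
    vanishes. *)
Lemma integral_policy_ratio_le1 (t : 'I_T) (pi pi' : X -> U -> R) :
  \int[ref]_xi (q xi)%:E = 1 ->
  is_policy mu pi -> is_marginal_ratio mu ref q t pi -> is_policy mu pi' ->
  \int[ref]_xi (q xi *
    (pi' (state t xi) (action t xi) / pi (state t xi) (action t xi)))%:E <= 1.
Proof.
move=> q1 piP pi_ratio [mpi' pi'0 pi'1]; have [mpi pi0 _] := piP.
pose h z : \bar R := (pi' z.1 z.2 / pi z.1 z.2)%:E.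
have mh : measurable_fun setT h.
  apply/measurable_EFinP/measurable_funM => //; exact: measurable_inv_ge0.
have h0 z : 0 <= h z by rewrite lee_fin divr_ge0.
under eq_integral do rewrite EFinM.
rewrite (@marginal_ratio_integral t pi h)// -[leRHS]q1.
have q_state_law : \int[ref]_xi (q xi)%:E = \int[state_law ref q t]_x cst 1 x.
  by rewrite integral_state_law//; apply: eq_integral => xi _; rewrite mule1.
rewrite q_state_law; have [mx ->] := state_law_measure t.
have mpih : measurable_fun setT (fun z => (pi z.1 z.2)%:E * h z).
  by apply: emeasurable_funM => //; exact/measurable_EFinP.
have pih0 z : 0 <= (pi z.1 z.2)%:E * h z by rewrite mule_ge0// lee_fin.
apply: ge0_le_integral => //.
- by move=> x _; apply: integral_ge0 => u _; exact: (pih0 (x, u)).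
- exact: (measurable_fun_fubini_tonelli_F (fun z => (pi z.1 z.2)%:E * h z)).
move=> x _; rewrite /= -(pi'1 x); apply: ge0_le_integral => //.
- by move=> u _; exact: (pih0 (x, u)).
- exact: (measurableT_comp mpih (pair1_measurable x)).
- by apply/measurable_EFinP; exact: (measurableT_comp mpi' (pair1_measurable x)).
move=> u _; rewrite /h/= -EFinM lee_fin.
have [->|pi_neq0] := eqVneq (pi x u) 0%R; first by rewrite mul0r.
by rewrite mulrC divfK.
Qed.

End marginal_ratio.

(** * The posterior and the lower bound *)

Section posterior.
Context dX dU (X : measurableType dX) (U : measurableType dU) (R : realType).
Variable mu : {sigma_finite_measure set U -> \bar R}.
Variables (T : nat) (x0 : X) (f : 'I_T -> {mfun (X * U)%type >-> X}).
Variables (c : 'I_T -> X * U -> R) (cT : X -> R).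
Hypotheses (mc : forall t, measurable_fun setT (c t))
  (mcT : measurable_fun setT cT)
  (c_ge0 : forall t z, 0 <= c t z) (cT_ge0 : forall x, 0 <= cT x).

Local Notation ref := (dynamics_measure mu x0 f).
Local Notation observed g pi :=
  (fun t z => observation g (c t z) * pi t z.1 z.2).

Lemma measurable_observation d (S : measurableType d) (g : R) (r : S -> R) :
  measurable_fun setT r -> measurable_fun setT (fun s => observation g (r s)).
Proof.
move=> mr; apply: measurable_funM => //.
apply: (measurableT_comp (@measurable_expR R)).
apply: (measurableT_comp (@oppr_measurable R setT)).
exact: measurable_funM.
Qed.

Lemma observation_bounds (g r : R) : 0 < g -> 0 <= r -> 0 < observation g r <= g.
Proof.
move=> g0 r0; rewrite mulr_gt0 ?expR_gt0//= ger_pMr//.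
by rewrite -expR0 ler_expR oppr_le0 mulr_ge0// ltW.
Qed.

(** The observation factor lies in (0, g] and the policy has mass 1. *)
Lemma observed_bounded_weight (g : R) (pi : 'I_T -> X -> U -> R) t :
  0 < g -> is_policy mu (pi t) -> bounded_weight mu g (observed g pi t).
Proof.
move=> g0 [mpi pi0 pi1].
have mopi : measurable_fun setT (observed g pi t).
  by apply: measurable_funM => //; exact: measurable_observation.
have o0 z : 0 < observation g (c t z) <= g by exact: observation_bounds.
have opi0 z : 0 <= observed g pi t z.
  by rewrite mulr_ge0//; have /andP[/ltW] := o0 z.
split => // x.
have mpix : measurable_fun setT (fun u => (pi t x u)%:E).
  by apply/measurable_EFinP; exact: (measurableT_comp mpi (pair1_measurable x)).
have mopix : measurable_fun setT (fun u => (observed g pi t (x, u))%:E).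
  by apply/measurable_EFinP; exact: (measurableT_comp mopi (pair1_measurable x)).
apply/andP; split.
  apply: (@integral_gt0_trans _ _ _ _ (fun u => (pi t x u)%:E)) => //.
  - by move=> u; rewrite lee_fin.
  - by move=> u; rewrite lee_fin.
  - move=> u [/eqP]; rewrite mulf_eq0 => /orP[|/eqP->//].
    by have /andP[/gt_eqF->] := o0 (x, u).
  - by rewrite pi1.
rewrite -[leRHS]mule1 -(pi1 x) -ge0_integralZl//; first last.
- by rewrite lee_fin ltW.
- by move=> u _; rewrite lee_fin.
apply: ge0_le_integral => //.
- by move=> u _; rewrite lee_fin.
- exact: measurable_funeM.
- move=> u _; rewrite -EFinM lee_fin ler_wpM2r//.
  by have /andP[] := o0 (x, u).
Qed.

Lemma observed_bounded_potential (g : R) :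
  0 < g -> bounded_potential g (fun x => observation g (cT x)).
Proof.
move=> g0; split; first exact: measurable_observation.
by move=> x; exact: observation_bounds.
Qed.

Lemma joint_traj_weight (pi : 'I_T -> X -> U -> R) g xi :
  joint c cT pi g xi =
  traj_weight (observed g pi) xi * observation g (cT xi.2).
Proof. by rewrite /joint mulrC. Qed.

(** The [T] stage observations and the terminal one each contribute a factor [g], whence the
    exponent and, later, the numerator of the optimal parameter. *)
Lemma jointE (pi : 'I_T -> X -> U -> R) g xi :
  joint c cT pi g xi = g ^+ T.+1 * expR (- (g * cost c cT xi)) *
    \prod_(t < T) pi t (state t xi) (action t xi).
Proof.
rewrite /joint big_split/= mulrA; congr (_ * _).
rewrite /observation big_split/= prodr_const card_ord -expR_sum exprS /cost.
by rewrite mulrDr mulr_sumr opprD expRD -sumrN; ring.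
Qed.

Lemma joint_ge0 (pi : 'I_T -> X -> U -> R) g xi :
  (forall t, is_policy mu (pi t)) -> 0 < g -> 0 <= joint c cT pi g xi.
Proof.
move=> piP g0; rewrite jointE mulr_ge0//.
  by rewrite mulr_ge0 ?expR_ge0// exprn_ge0// ltW.
by apply: prodr_ge0 => t _; case: (piP t).
Qed.

Lemma measurable_joint (pi : 'I_T -> X -> U -> R) g :
  (forall t, is_policy mu (pi t)) -> measurable_fun setT (joint c cT pi g).
Proof.
move=> piP; rewrite (funext (joint_traj_weight pi g)).
apply: measurable_funM.
  apply: measurable_traj_weight => t; apply: measurable_funM.
    exact: measurable_observation.
  by case: (piP t).
apply: measurable_observation.
exact: (measurableT_comp mcT measurable_snd).
Qed.

Lemma evidence_bounds (pi : 'I_T -> X -> U -> R) g :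
  (forall t, is_policy mu (pi t)) -> 0 < g ->
  (0 < evidence ref c cT pi g <= (g ^+ T * g)%:E)%E.
Proof.
move=> piP g0; rewrite /evidence.
under eq_integral do rewrite joint_traj_weight.
exact: (integral_traj_weight_bounds x0 f
  (fun t => observed_bounded_weight g0 (piP t)) (observed_bounded_potential g0)).
Qed.

Lemma measurable_cost : measurable_fun setT (cost c cT).
Proof.
apply: measurable_funD; first exact: (measurableT_comp mcT measurable_snd).
apply: measurable_sum => t.
exact: (measurableT_comp (mc t) (measurable_state_action t)).
Qed.

Lemma cost_ge0 xi : 0 <= cost c cT xi.
Proof. by rewrite addr_ge0//; apply: sumr_ge0. Qed.

(** * Normalization of the posterior and existence of marginal ratios *)

Variables (rho : 'I_T -> X -> U -> R) (lambda : R).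
Hypotheses (rhoP : forall t, is_policy mu (rho t)) (lambda_gt0 : 0 < lambda).

Local Notation q := (posterior ref c cT rho lambda).
Local Notation Z := (fine (evidence ref c cT rho lambda)).

Lemma evidenceE : Z%:E = evidence ref c cT rho lambda.
Proof.
have /andP[ev0 evle] := evidence_bounds rhoP lambda_gt0.
by rewrite fineK// ge0_fin_numE ?ltW// (le_lt_trans evle)// ltry.
Qed.

Lemma evidence_gt0 : 0 < Z.
Proof.
rewrite -lte_fin evidenceE.
by have /andP[] := evidence_bounds rhoP lambda_gt0.
Qed.

Lemma measurable_posterior : measurable_fun setT q.
Proof. by apply: measurable_funM => //; exact: measurable_joint. Qed.

Lemma posterior_ge0 xi : 0 <= q xi.
Proof. by rewrite divr_ge0 ?joint_ge0 ?ltW ?evidence_gt0. Qed.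

Lemma integral_posterior : (\int[ref]_xi (q xi)%:E = 1)%E.
Proof.
under eq_integral do rewrite /posterior mulrC EFinM.
rewrite ge0_integralZl//; first last.
- by rewrite lee_fin invr_ge0 ltW// evidence_gt0.
- by move=> xi _; rewrite lee_fin joint_ge0.
- by apply/measurable_EFinP; exact: measurable_joint.
rewrite -[X in (_ * X)%E]/(evidence ref c cT rho lambda) -evidenceE -EFinM.
by rewrite mulVf// gt_eqF// evidence_gt0.
Qed.

(** The disintegration provides both marginal densities. The state density is positive everywhere,
    so the quotient is a policy at every state. *)
Lemma marginal_ratio_exists (t : 'I_T) :
  exists pi, is_policy mu pi /\ is_marginal_ratio mu ref q t pi.
Proof.
have wB s := observed_bounded_weight lambda_gt0 (rhoP s).
have [nu [V [M [VM nuE]]]] := state_action_disintegration x0 f t wB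
  (observed_bounded_potential lambda_gt0).
pose w : X * U -> R := observed lambda rho t.
have {}wB : bounded_weight mu lambda w := wB t.
have {}nuE : forall h : X * U -> \bar R, measurable_fun setT h ->
    (forall z, 0 <= h z)%E ->
    (\int[ref]_xi (h (state_action t xi) * (joint c cT rho lambda xi)%:E) =
     \int[nu]_x \int[mu]_u (h (x, u) * (w (x, u) * V (f t (x, u)))%:E))%E.
  move=> h mh h0; rewrite -[RHS]nuE//.
  by apply: eq_integral => xi _; rewrite joint_traj_weight.
have [mw w0 _] := wB; have [mV V0] := VM.
have [mmsg msg0] := message_potential (f t) wB VM.
have msgE := messageE (f t) wB VM.
have Z0 := evidence_gt0.
pose p_xu z := w z * V (f t z) / Z.
pose p_x x := message mu w (f t) V x / Z.
have mp_xu : measurable_fun setT p_xu.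
  by do 2 apply: measurable_funM => //; exact: measurableT_comp.
have p_xu0 z : 0 <= p_xu z.
  have /andP[/ltW Vf0 _] := V0 (f t z).
  by rewrite /p_xu divr_ge0 ?(ltW Z0)// mulr_ge0.
have mp_x : measurable_fun setT p_x by exact: measurable_funM.
have p_x0 x : 0 < p_x x by rewrite divr_gt0//; have /andP[] := msg0 x.
have mp_xux x : measurable_fun setT (fun u => (p_xu (x, u))%:E).
  by apply/measurable_EFinP; exact: (measurableT_comp mp_xu (pair1_measurable x)).
have p_xE x : ((p_x x)%:E = \int[mu]_u (p_xu (x, u))%:E)%E.
  rewrite /p_x EFinM msgE muleC -ge0_integralZl//.
  - by apply: eq_integral => u _; rewrite -EFinM mulrC.
  - apply/measurable_EFinP/measurable_funM.
      exact: (measurableT_comp mw (pair1_measurable x)).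
    by apply: (measurableT_comp mV); exact: (measurableT_comp _ (pair1_measurable x)).
  - move=> u _; rewrite lee_fin mulr_ge0//.
    by have /andP[/ltW] := V0 (f t (x, u)).
  - by rewrite lee_fin invr_ge0 ltW.
have lawE (A : set (X * U)) : measurable A -> (state_action_law ref q t A =
    \int[nu]_x \int[mu]_u ((\1_A (x, u))%:E * (p_xu (x, u))%:E))%E.
  move=> mA; rewrite /state_action_law /pushforward /law.
  rewrite integral_mkcond.
  (* The normalizing constant is absorbed into the test function of the disintegration. *)
  have m1 : measurable_fun setT (fun z => (Z^-1 * \1_A z)%:E).
    by apply/measurable_EFinP/measurable_funM => //; exact: measurable_indic.
  have h0 z : (0 <= (Z^-1 * \1_A z)%:E)%E.
    by rewrite lee_fin mulr_ge0// invr_ge0 ltW.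
  transitivity (\int[nu]_x \int[mu]_u
      ((Z^-1 * \1_A (x, u))%:E * (w (x, u) * V (f t (x, u)))%:E))%E.
    rewrite -(nuE (fun z => (Z^-1 * \1_A z)%:E))//; apply: eq_integral => xi _.
    rewrite patchE indicE /posterior; have -> : (xi \in state_action t @^-1` A) =
      (state_action t xi \in A) by apply/idP/idP; rewrite !inE.
    case: ifPn => _; first by rewrite mulr1 -EFinM mulrC.
    by rewrite mulr0 mul0e.
  apply: eq_integral => x _; apply: eq_integral => u _.
  by rewrite -!EFinM /p_xu; congr (_%:E); ring.
exists (fun x u => p_xu (x, u) / p_x x); split; first split.
- apply: measurable_funM.
    by under eq_fun do rewrite -surjective_pairing.
  apply: measurable_inv_ge0; first by move=> z; exact: ltW.
  exact: (measurableT_comp mp_x measurable_fst).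
- by move=> x u; rewrite divr_ge0// ltW.
- move=> x; under eq_integral do rewrite mulrC EFinM.
  rewrite ge0_integralZl//; first last.
  + by rewrite lee_fin invr_ge0 ltW.
  + by move=> u _; rewrite lee_fin.
  by rewrite -p_xE -EFinM mulVf// gt_eqF.
exists nu, p_xu, p_x; split => //; split => //.
- move=> A mA; rewrite lawE// [RHS]integral_mkcond.
  rewrite (_ : (fun z => (p_xu z)%:E) \_ A = (fun z => (\1_A z)%:E * (p_xu z)%:E)%E); last first.
    apply/funext => z; rewrite patchE indicE.
    by case: ifPn => _; rewrite ?mul1e ?mul0e.
  rewrite (fubini_tonelli1 (fun z => (\1_A z)%:E * (p_xu z)%:E)%E)//.
    apply: emeasurable_funM; last exact/measurable_EFinP.
    by apply/measurable_EFinP; exact: measurable_indic.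
  by move=> z; rewrite mule_ge0// lee_fin.
- by move=> x; exact: ltW.
- move=> A mA; have mAT : measurable (A `*` [set: U]) by exact: measurableX.
  transitivity (state_action_law ref q t (A `*` setT)).
    by rewrite /state_action_law /pushforward; congr law; apply/seteqP; split => xi //= [].
  rewrite lawE// [RHS]integral_mkcond; apply: eq_integral => x _.
  rewrite patchE; case: ifPn => xA.
    rewrite p_xE; apply: eq_integral => u _.
    by rewrite indicE in_setX/= xA in_setT mul1e.
  by apply: integral0_eq => u _; rewrite indicE in_setX/= (negbTE xA) mul0e.
Qed.

(** * Integrability under the posterior and the log gap between two joint densities *)

Local Notation ratio pi' pi t xi :=
  (pi' t (state t xi) (action t xi) / pi t (state t xi) (action t xi)).

Lemma integrable_posterior : ref.-integrable setT (fun xi => (q xi)%:E).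
Proof.
apply/integrableP; split; first by apply/measurable_EFinP; exact: measurable_posterior.
under eq_integral do rewrite gee0_abs ?lee_fin ?posterior_ge0//.
by rewrite integral_posterior ltry.
Qed.

Lemma integrable_joint (pi : 'I_T -> X -> U -> R) g :
  (forall t, is_policy mu (pi t)) -> 0 < g ->
  ref.-integrable setT (fun xi => (joint c cT pi g xi)%:E).
Proof.
move=> piP g0; apply/integrableP; split.
  by apply/measurable_EFinP; exact: measurable_joint.
under eq_integral do rewrite gee0_abs ?lee_fin ?joint_ge0//.
have /andP[_ /le_lt_trans] := evidence_bounds piP g0.
by apply; rewrite ltry.
Qed.

(** The exponential in the posterior compensates the cost:
    [lambda * C * expR (- (lambda * C)) <= 1], so [q * C] is dominated by a multiple of the product
    of the prior policies. *)
Lemma integrable_posterior_cost :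
  ref.-integrable setT (fun xi => (q xi * cost c cT xi)%:E).
Proof.
pose r t (z : X * U) := rho t z.1 z.2.
have rB t : bounded_weight mu 1 (r t).
  by have [mr r0 r1] := rhoP t; split=> // [z|x]; [exact: r0|rewrite r1 lte01 lexx].
have cM : bounded_potential 1 (cst 1 : X -> R).
  by split=> [|x]; rewrite ?ltr01 ?lexx.
have mW : measurable_fun setT (traj_weight r).
  by apply: measurable_traj_weight => t; case: (rB t).
have W0 xi : 0 <= traj_weight r xi by apply: traj_weight_ge0 => t z; case: (rB t).
have intW : ref.-integrable setT (fun xi => (traj_weight r xi)%:E).
  apply/integrableP; split; first exact/measurable_EFinP.
  under eq_integral do rewrite gee0_abs ?lee_fin//.
  rewrite (eq_integral (fun xi => (traj_weight r xi * cst 1 xi.2)%:E)).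
    have /andP[_ /le_lt_trans] := integral_traj_weight_bounds x0 f rB cM.
    by apply; rewrite ltry.
  by move=> xi _; rewrite mulr1.
apply: le_integrable (integrableZl measurableT (lambda ^+ T / Z) intW) => //.
  apply/measurable_EFinP/measurable_funM; last exact: measurable_cost.
  exact: measurable_posterior.
move=> xi _; rewrite -EFinM !gee0_abs ?lee_fin; first last.
- by rewrite mulr_ge0 ?posterior_ge0 ?cost_ge0.
- by rewrite mulr_ge0// divr_ge0 ?exprn_ge0 ?ltW ?evidence_gt0.
have C0 := cost_ge0 xi; set C := cost c cT xi in C0 *.
have lC : lambda * C * expR (- (lambda * C)) <= 1.
  rewrite expRN ler_pdivrMr ?expR_gt0// mul1r.
  by rewrite (le_trans _ (expR_ge1Dx _))// lerDr.
rewrite /posterior jointE -/C.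
set W := \prod_(t < T) _; have -> : traj_weight r xi = W by [].
(* One of the [T.+1] factors [lambda] is spent on the cost. *)
rewrite (_ : _ * C = lambda ^+ T / Z * W * (lambda * C * expR (- (lambda * C)))); last first.
  by rewrite exprSr; ring.
apply: ler_piMr => //; apply: mulr_ge0; last exact: (W0 xi).
by rewrite divr_ge0 ?exprn_ge0 ?ltW ?evidence_gt0.
Qed.

(** An upper bound for the logarithm of the joint density at [(pi', g')] over that at [(pi, g)],
    chosen affine in the cost and in the policy ratios. *)
Definition log_gap (pi : 'I_T -> X -> U -> R) (g : R)
    (pi' : 'I_T -> X -> U -> R) (g' : R) (xi : T.-tuple (X * U)%type * X) : R :=
  T.+1%:R * (g' / g - 1) - (g' - g) * cost c cT xi +
  \sum_(t < T) (ratio pi' pi t xi - 1).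

(* [r <= exp (r - 1)] for the ratio of the parameters and for the ratio of the
   action densities at each time. *)
Lemma joint_le_log_gap (pi pi' : 'I_T -> X -> U -> R) g g' xi :
  (forall t, is_policy mu (pi' t)) -> 0 < g -> 0 < g' ->
  (forall t, 0 < pi t (state t xi) (action t xi)) ->
  joint c cT pi' g' xi <= joint c cT pi g xi * expR (log_gap pi g pi' g' xi).
Proof.
move=> pi'P g0 g'0 pi0; rewrite !jointE.
have ler1 (r : R) : r <= expR (r - 1).
  by rewrite (le_trans _ (expR_ge1Dx _))// addrC subrK.
have prod_le : \prod_(t < T) pi' t (state t xi) (action t xi) <=
    \prod_(t < T) pi t (state t xi) (action t xi) *
    expR (\sum_(t < T) (ratio pi' pi t xi - 1)).
  rewrite expR_sum -big_split/=; apply: ler_prod => t _.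
  have [_ -> _] := pi'P t; rewrite -ler_pdivrMl// mulrC; exact: ler1.
have pow_le : g' ^+ T.+1 <= g ^+ T.+1 * expR (T.+1%:R * (g' / g - 1)).
  rewrite expRM_natl -exprMn; apply: lerXn2r; rewrite ?nnegrE.
  - exact: ltW.
  - by rewrite mulr_ge0 ?expR_ge0// ltW.
  - by rewrite -ler_pdivrMl// mulrC; exact: ler1.
apply: (@le_trans _ _ ((g ^+ T.+1 * expR (T.+1%:R * (g' / g - 1))) *
    expR (- (g' * cost c cT xi)) *
    (\prod_(t < T) pi t (state t xi) (action t xi) *
     expR (\sum_(t < T) (ratio pi' pi t xi - 1))))).
  apply: ler_pM => //.
  - by rewrite mulr_ge0 ?expR_ge0// exprn_ge0// ltW.
  - by apply: prodr_ge0 => t _; case: (pi'P t).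
  - by rewrite ler_wpM2r ?expR_ge0.
rewrite /log_gap !expRD le_eqVlt; apply/orP; left; apply/eqP.
rewrite (_ : - ((g' - g) * _) = - (g' * cost c cT xi) + g * cost c cT xi); last by ring.
have expgC : expR (- (g * cost c cT xi)) * expR (g * cost c cT xi) = 1.
  by rewrite -expRD addNr expR0.
by rewrite expRD -[LHS]mulr1 -[X in _ * X = _]expgC; ring.
Qed.

Lemma integrable_posterior_ratio (pi pi' : 'I_T -> X -> U -> R) t :
  (forall t, is_policy mu (pi t)) ->
  (forall t, is_marginal_ratio mu ref q t (pi t)) ->
  (forall t, is_policy mu (pi' t)) ->
  ref.-integrable setT (fun xi => (q xi * ratio pi' pi t xi)%:E).
Proof.
move=> piP pi_ratio pi'P; have [mpi pi0 _] := piP t; have [mpi' pi'0 _] := pi'P t.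
apply/integrableP; split.
  apply/measurable_EFinP/measurable_funM; first exact: measurable_posterior.
  apply: measurable_funM.
    exact: (measurableT_comp mpi' (measurable_state_action t)).
  apply: measurable_inv_ge0; first by move=> xi; exact: pi0.
  exact: (measurableT_comp mpi (measurable_state_action t)).
apply: (@le_lt_trans _ _ 1%E); last exact: ltry.
rewrite (eq_integral (fun xi => (q xi * ratio pi' pi t xi)%:E)); last first.
  move=> xi _; rewrite gee0_abs// lee_fin mulr_ge0 ?posterior_ge0//.
  by rewrite divr_ge0.
apply: integral_policy_ratio_le1 => //; first exact: measurable_posterior.
  by move=> xi; exact: posterior_ge0.
exact: integral_posterior.
Qed.

Section gap.
Variables (pi pi' : 'I_T -> X -> U -> R) (g g' : R).
Hypotheses (piP : forall t, is_policy mu (pi t))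
  (pi_ratio : forall t, is_marginal_ratio mu ref q t (pi t))
  (pi'P : forall t, is_policy mu (pi' t)).

Local Notation gap := (log_gap pi g pi' g').

Let gapE xi : ((q xi * gap xi)%:E =
  ((T.+1%:R * (g' / g - 1))%:E * (q xi)%:E +
   (- (g' - g))%:E * (q xi * cost c cT xi)%:E) +
  \sum_(t < T) ((q xi * ratio pi' pi t xi)%:E - (q xi)%:E))%E.
Proof.
under eq_bigr do rewrite -EFinB.
rewrite sumEFin -!EFinM -!EFinD; congr (_%:E).
rewrite /log_gap mulrDr mulr_sumr; congr (_ + _); first by ring.
by apply: eq_bigr => t _; ring.
Qed.

Let int_ratio t : ref.-integrable setT
  (fun xi => (q xi * ratio pi' pi t xi)%:E - (q xi)%:E)%E.
Proof.
by apply: integrableB => //; [exact: integrable_posterior_ratio|exact: integrable_posterior].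
Qed.

Let int_lin : ref.-integrable setT
  (fun xi => (T.+1%:R * (g' / g - 1))%:E * (q xi)%:E +
   (- (g' - g))%:E * (q xi * cost c cT xi)%:E)%E.
Proof.
apply: integrableD => //; apply: integrableZl => //.
- exact: integrable_posterior.
- exact: integrable_posterior_cost.
Qed.

Lemma integrable_log_gap :
  ref.-integrable setT (fun xi => (q xi * gap xi)%:E).
Proof.
under eq_fun do rewrite gapE.
by apply: integrableD => //; exact: integrable_sum.
Qed.

Lemma integral_log_gap_le0 : 0 < g ->
  (\int[ref]_xi (q xi * cost c cT xi)%:E = (T.+1%:R / g)%:E)%E ->
  (\int[ref]_xi (q xi * gap xi)%:E <= 0)%E.
Proof.
move=> g0 costE; under eq_integral do rewrite gapE.
have intq := integrable_posterior; have intqC := integrable_posterior_cost.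
rewrite integralD//; last exact: integrable_sum.
rewrite integralD//; [|exact: integrableZl..].
rewrite !integralZl// integral_posterior costE mule1 -EFinM -EFinD.
(* Here the choice of [g] enters: with mean cost [T.+1%:R / g] the parameter terms cancel for every
   [g']. *)
have -> : T.+1%:R * (g' / g - 1) + - (g' - g) * (T.+1%:R / g) = 0 :> R.
  by field; rewrite gt_eqF.
rewrite add0e integral_sum//; apply: sume_le0 => t _.
rewrite integralB//; last exact: integrable_posterior_ratio.
rewrite integral_posterior sube_le0.
apply: integral_policy_ratio_le1 => //; first exact: measurable_posterior.
  by move=> xi; exact: posterior_ge0.
exact: integral_posterior.
Qed.

End gap.

(** * Finiteness and maximality of the evidence lower bound *)

Definition elbo_integrand (pi : 'I_T -> X -> U -> R) (g : R)
    (xi : T.-tuple (X * U)%type * X) : \bar R :=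
  ((q xi)%:E * lne (joint c cT pi g xi / q xi)%:E)%E.

Section elbo.
Variables (pi : 'I_T -> X -> U -> R) (g : R).
Hypotheses (piP : forall t, is_policy mu (pi t))
  (pi_ratio : forall t, is_marginal_ratio mu ref q t (pi t)) (g0 : 0 < g).

Lemma measurable_elbo_integrand (pi' : 'I_T -> X -> U -> R) g' :
  (forall t, is_policy mu (pi' t)) -> measurable_fun setT (elbo_integrand pi' g').
Proof.
move=> pi'P; apply: emeasurable_funM.
  by apply/measurable_EFinP; exact: measurable_posterior.
apply: measurable_lne_EFin; apply: measurable_funM; first exact: measurable_joint.
by apply: measurable_inv_ge0; [exact: posterior_ge0|exact: measurable_posterior].
Qed.

(** From [ln y < y] at [y = p / q]; where [q > 0] and [p = 0] the integrand is -oo. *)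
Lemma elbo_integrand_le_joint xi :
  (elbo_integrand pi g xi <= (joint c cT pi g xi)%:E)%E.
Proof.
have j0 := joint_ge0 xi piP g0; have := posterior_ge0 xi.
rewrite /elbo_integrand le_eqVlt => /orP[/eqP<-|q0]; first by rewrite mul0e lee_fin.
move: j0; rewrite le_eqVlt => /orP[/eqP<-|j0].
  by rewrite mul0r le0_lneNy// gt0_muleNy ?leNye.
have y0 := divr_gt0 j0 q0.
rewrite lne_EFin// -EFinM lee_fin mulrC -ler_pdivlMr//.
by rewrite ltW// ln_sublinear.
Qed.

(** The logarithm of [joint_le_log_gap], weighted by [q]. Both sides are 0 where [q] vanishes, and
    the left one is -oo where only the competitor's joint density does. *)
Lemma elbo_integrand_log_gap (pi' : 'I_T -> X -> U -> R) g' xi :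
  (forall t, is_policy mu (pi' t)) -> 0 < g' ->
  (0 < q xi -> forall t, 0 < pi t (state t xi) (action t xi)) ->
  (elbo_integrand pi' g' xi <=
   elbo_integrand pi g xi + (q xi * log_gap pi g pi' g' xi)%:E)%E.
Proof.
move=> pi'P g'0 pi0; have := posterior_ge0 xi.
rewrite /elbo_integrand le_eqVlt => /orP[/eqP<-|q0].
  by rewrite !mul0e mul0r adde0.
have j0 : 0 < joint c cT pi g xi.
  rewrite jointE mulr_gt0 ?mulr_gt0 ?expR_gt0 ?exprn_gt0//.
  by apply: prodr_gt0 => t _; exact: pi0.
have := joint_ge0 xi pi'P g'0; rewrite le_eqVlt => /orP[/eqP<-|j'0].
  by rewrite mul0r le0_lneNy// gt0_muleNy ?leNye.
have y0 := divr_gt0 j0 q0; have y'0 := divr_gt0 j'0 q0.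
have expG0 := expR_gt0 (log_gap pi g pi' g' xi).
rewrite !lne_EFin// -!EFinM -EFinD lee_fin -mulrDr ler_pM2l//.
rewrite -[log_gap _ _ _ _ _]expRK -lnM ?posrE//.
rewrite ler_ln ?posrE//; last exact: mulr_gt0.
rewrite [leRHS]mulrAC ler_pM2r; last by rewrite invr_gt0.
by apply: joint_le_log_gap => //; exact: pi0.
Qed.

Lemma ae_policy_gt0 : {ae ref, forall xi,
  0 < q xi -> forall t, 0 < pi t (state t xi) (action t xi)}.
Proof.
have : {ae ref, forall xi, forall t,
    0 < q xi -> 0 < pi t (state t xi) (action t xi)}.
  apply: filter_forall => t; apply: marginal_ratio_gt0 => //.
  - exact: measurable_posterior.
  - by move=> xi; exact: posterior_ge0.
by apply: filterS => xi H q0 t; exact: H.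
Qed.

Lemma integrable_elbo_integrand : ref.-integrable setT (elbo_integrand pi g).
Proof.
(* The lower bound obtained from the prior as competitor, whose integrand is [q * ln Z]. *)
pose b xi := q xi * ln Z - q xi * log_gap pi g rho lambda xi.
have intb : ref.-integrable setT (fun xi => (b xi)%:E).
  under eq_fun do rewrite EFinB mulrC EFinM.
  apply: integrableB => //; last exact: integrable_log_gap.
  by apply: integrableZl => //; exact: integrable_posterior.
have intj := integrable_joint piP g0.
have j0 xi := joint_ge0 xi piP g0.
have int_bound : ref.-integrable setT
    (fun xi => (joint c cT pi g xi)%:E + `|(b xi)%:E|)%E.
  by apply: integrableD => //; exact: integrable_abse.
have mE := measurable_elbo_integrand g piP.
apply/integrableP; split => //.
have /integrableP[mbound] := int_bound; apply: le_lt_trans.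
apply: ae_ge0_le_integral => //; [exact: measurableT_comp..|].
apply: filterS ae_policy_gt0 => xi pi0 _.
rewrite [leRHS]gee0_abs ?adde_ge0 ?lee_fin//.
have Eb : ((b xi)%:E <= elbo_integrand pi g xi)%E.
  have := elbo_integrand_log_gap rhoP lambda_gt0 pi0.
  rewrite /b EFinB leeBlDr//; apply: le_trans.
  have := posterior_ge0 xi; rewrite /elbo_integrand le_eqVlt => /orP[/eqP<-|q0].
    by rewrite mul0r mul0e.
  (* Where [q > 0], the prior joint density divided by [q] is exactly the evidence. *)
  have jr0 : joint c cT rho lambda xi != 0.
    by apply: contraTneq q0 => j; rewrite /posterior j mul0r ltxx.
  rewrite {3}/posterior invf_div mulrCA divff// mulr1.
  by rewrite lne_EFin// evidence_gt0.
move: Eb (elbo_integrand_le_joint xi).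
case: (elbo_integrand pi g xi) => [r| |]//=; rewrite !lee_fin => br rj.
have := ler_norm (b xi); have := ler_norm (- b xi); have := j0 xi.
by rewrite normrN ler_norml => *; apply/andP; split; lra.
Qed.

End elbo.

Local Notation mean_cost := (expect ref q (fun xi => (cost c cT xi)%:E)).

Lemma mean_costE :
  (mean_cost = \int[ref]_xi (q xi * cost c cT xi)%:E)%E.
Proof. by apply: eq_integral => xi _; rewrite EFinM. Qed.

Lemma mean_cost_gt0 : mean_cost <> 0%E -> 0 < fine mean_cost.
Proof.
move=> C_neq0; apply: fine_gt0; rewrite lt0e; apply/andP; split.
  apply/andP; split; first exact/eqP.
  rewrite mean_costE; apply: integral_ge0 => xi _.
  by rewrite lee_fin mulr_ge0 ?posterior_ge0 ?cost_ge0.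
rewrite mean_costE ltey_eq; apply/orP; left.
exact: integrable_fin_num integrable_posterior_cost.
Qed.

Lemma elbo_maximum (pi : 'I_T -> X -> U -> R) :
  mean_cost <> 0%E -> (forall t, is_policy mu (pi t)) ->
  (forall t, is_marginal_ratio mu ref q t (pi t)) ->
  elbo ref c cT q pi (T.+1%:R / fine mean_cost) \is a fin_num /\
  maximizes_elbo mu ref c cT q pi (T.+1%:R / fine mean_cost).
Proof.
move=> C_neq0 piP pi_ratio; have C0 := mean_cost_gt0 C_neq0.
set g := T.+1%:R / _.
have g0 : 0 < g by rewrite divr_gt0.
have intE := integrable_elbo_integrand piP pi_ratio g0.
have costE : (\int[ref]_xi (q xi * cost c cT xi)%:E = (T.+1%:R / g)%:E)%E.
  rewrite -mean_costE -[LHS]fineK; last first.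
    by rewrite mean_costE; exact: integrable_fin_num integrable_posterior_cost.
  by rewrite /g invf_div mulrC divfK.
split; first exact: integrable_fin_num intE.
split => // pi' g' pi'P g'0.
have intG := integrable_log_gap g g' piP pi_ratio pi'P.
(* The pointwise bound is integrated first; the sum is then split, both terms being integrable, and
   the gap has nonpositive integral. *)
apply: (@le_trans _ _ (\int[ref]_xi (elbo_integrand pi g xi +
    (q xi * log_gap pi g pi' g' xi)%:E))%E).
  apply: ae_le_integral; first exact: measurable_elbo_integrand.
    apply: emeasurable_funD; first exact: measurable_elbo_integrand.
    exact: measurable_int intG.
  apply: filterS (ae_policy_gt0 piP pi_ratio) => xi pi0.
  exact: elbo_integrand_log_gap.
rewrite integralD//; apply: geeDl; exact: integral_log_gap_le0.
Qed.

End posterior.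

Theorem theorem2 (R : realType) (nx nu T : nat)
    (x0 : vec R nx)
    (f : 'I_T -> {mfun (vec R nx * vec R nu)%type >-> vec R nx})
    (c : 'I_T -> vec R nx * vec R nu -> R) (cT : vec R nx -> R)
    (mc : forall t, measurable_fun setT (c t))
    (mcT : measurable_fun setT cT)
    (c_ge0 : forall t z, 0 <= c t z)
    (cT_ge0 : forall x, 0 <= cT x)
    (rho : 'I_T -> vec R nx -> vec R nu -> R) (lambda : R)
    (rho_policy : forall t, is_policy (lebesgue_vec R nu) (rho t))
    (lambda_gt0 : 0 < lambda) :
  let mu := lebesgue_vec R nu in
  let ref := dynamics_measure mu x0 f in
  let q := posterior ref c cT rho lambda in
  let mean_cost := expect ref q (fun xi => (cost c cT xi)%:E) in
  let gamma_star := T.+1%:R / fine mean_cost in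
  mean_cost <> 0%E ->
  (exists pi_star : 'I_T -> vec R nx -> vec R nu -> R,
     forall t, is_policy mu (pi_star t) /\
               is_marginal_ratio mu ref q t (pi_star t)) /\
  (forall pi_star : 'I_T -> vec R nx -> vec R nu -> R,
     (forall t, is_policy mu (pi_star t)) ->
     (forall t, is_marginal_ratio mu ref q t (pi_star t)) ->
     [/\ forall t, is_conditional_action_density mu ref q t (pi_star t),
         elbo ref c cT q pi_star gamma_star \is a fin_num &
         maximizes_elbo mu ref c cT q pi_star gamma_star]).
Proof.
move=> mu ref q mean_cost gamma_star C_neq0; split.
  have pi_ex t := marginal_ratio_exists x0 f mc mcT c_ge0 cT_ge0 rho_policy
    lambda_gt0 t.
  by have [pi piP] := choice pi_ex; exists pi.
move=> pi_star piP pi_ratio.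
have [Efin Emax] := elbo_maximum mc mcT c_ge0 cT_ge0 rho_policy lambda_gt0
  C_neq0 piP pi_ratio.
split => // t; apply: marginal_ratio_conditional_density => //.
- exact: measurable_posterior.
- exact: posterior_ge0.
Qed.
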